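(* Let $e>1$ be odd, $t\ge0$ an integer and $\mathbf c=(t+(1-e)/2,0)$. Let $\mu$ be a bipartition such that $|\mu,\mathbf c\rangle$ is a highest weight vertex of the crystal graph $\mathcal G_{\mathbf c,e}$. Then the $e$-core of $\Phi_t(\mu)$ is a $2$-core.
   Context: Crystal graph $\mathcal G_{\mathbf c,e}$ ($\mathbf c=(c_1,c_2)$): vertices $|\mu,\mathbf c\rangle$, $\mu$ a bipartition. Nodes $(a,b,j)$ with $(a,b)$ in the Young diagram of $\mu^j$ (row $a$, column $b$), content $b-a+c_j$, residue = content mod $e$; addable/removable nodes as usual. For residue $i$, order addable and removable $i$-nodes by increasing content, ties broken by putting larger component index $j$ first; form the word in $A$ (addable) and $R$ (removable), cancel consecutive $RA$ recursively to get $A^\alpha R^\beta$; the good addable $i$-node (if $\alpha>0$) is the node of the rightmost $A$. Edge $|\mu,\mathbf c\rangle\xrightarrow{i}|\nu,\mathbf c\rangle$ iff $\nu$ is $\mu$ plus its good addable $i$-node. A highest weight vertex is one with no incoming edge. $\Delta_t=(t,\dots,1)$. For a partition $\lambda$ with $\beta$-set $B$ of odd size, $\lambda^{(2)}=(\pi\{x/2: x\in B\text{ even}\},\pi\{(x-1)/2:x\in B\text{ odd}\})$ with $\pi(X)$ the partition with $\beta$-set $X$; if the $2$-core of $\lambda$ is $\Delta_t$, $\bar\lambda^{(2)}$ equals $\lambda^{(2)}$ for $t$ even and the swapped pair for $t$ odd. $\Phi_t(\mu)$ is the unique partition with $2$-core $\Delta_t$ and $\bar\lambda^{(2)}=\mu$.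 *)

(* Defs.v *)
From mathcomp Require Import all_boot all_order all_algebra ssrint intdiv.
Set Implicit Arguments. Unset Strict Implicit. Unset Printing Implicit Defensive.
Import GRing.Theory Num.Theory.

Definition is_partition (l : seq nat) : bool :=
  sorted geq l && all (fun x => 0 < x) l.

Definition is_bipartition (mu : seq nat * seq nat) : bool :=
  is_partition mu.1 && is_partition mu.2.

Definition staircase (t : nat) : seq nat := [seq t - i | i <- iota 0 t].

Definition betaset (r : nat) (l : seq nat) : seq nat :=
  [seq nth 0 l k.-1 + r - k | k <- iota 1 r].

Definition part_of_beta (X : seq nat) : seq nat :=
  let s := sort geq X in
  let m := size s in
  [seq x <- [seq nth 0 s k - (m - k.+1) | k <- iota 0 m] | 0 < x].

(* e-core via the abacus: slide all beads of each runner to the top *)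
Definition ecore (e : nat) (l : seq nat) : seq nat :=
  let B := betaset (size l) l in
  part_of_beta (flatten [seq [seq c + e * i | i <- iota 0 (count (fun x => x %% e == c) B)]
                 | c <- iota 0 e]).

Definition is_core (e : nat) (l : seq nat) : bool := ecore e l == l.

Definition quot2 (l : seq nat) : seq nat * seq nat :=
  let r := if odd (size l) then size l else (size l).+1 in
  let B := betaset r l in
  (part_of_beta [seq x./2 | x <- B & ~~ odd x], part_of_beta [seq x./2 | x <- B & odd x]).

Definition barquot2 (t : nat) (l : seq nat) : seq nat * seq nat :=
  if odd t then ((quot2 l).2, (quot2 l).1) else quot2 l.

(* Phi_t(mu) = lam : the (unique) partition with 2-core Delta_t and bar lambda^(2) = mu *)
Definition Phi_rel (t : nat) (mu : seq nat * seq nat) (lam : seq nat) : bool :=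
  [&& is_partition lam, ecore 2 lam == staircase t & barquot2 t lam == mu].

(* a node (a, b, j) : row a >= 1, column b >= 1, component j in {1,2} *)
Definition node := (nat * nat * nat)%type.
Definition nrow (x : node) := x.1.1.
Definition ncol (x : node) := x.1.2.
Definition ncomp (x : node) := x.2.

Definition addables (p : seq nat) (j : nat) : seq node :=
  [seq (a, (nth 0 p a.-1).+1, j) | a <- iota 1 (size p).+1 &
       (a == 1) || (nth 0 p a.-1 < nth 0 p a.-2)].

Definition removables (p : seq nat) (j : nat) : seq node :=
  [seq (a, nth 0 p a.-1, j) | a <- iota 1 (size p) & nth 0 p a < nth 0 p a.-1].

Definition content (c : int * int) (x : node) : int :=
  (Posz (ncol x) - Posz (nrow x) + (if ncomp x == 1 then c.1 else c.2))%R.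

Definition has_residue (e : nat) (c : int * int) (i : nat) (x : node) : bool :=
  ((content c x %% Posz e)%Z == Posz i).

(* letters: (true, x) = A (addable), (false, x) = R (removable) *)
Definition letter := (bool * node)%type.

Definition letter_le (c : int * int) (u v : letter) : bool :=
  (content c u.2 < content c v.2)%R ||
  ((content c u.2 == content c v.2) && (ncomp v.2 <= ncomp u.2)).

Definition iword (e : nat) (c : int * int) (mu : seq nat * seq nat) (i : nat)
  : seq letter :=
  sort (letter_le c)
    [seq u <- [seq (true, x) | x <- addables mu.1 1 ++ addables mu.2 2] ++
              [seq (false, x) | x <- removables mu.1 1 ++ removables mu.2 2]
    | has_residue e c i u.2].

Fixpoint cancel1 (w : seq letter) : seq letter :=
  match w with
  | [::] => [::]
  | u :: w' =>
      match w' with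
      | v :: w'' => if (~~ u.1) && v.1 then w'' else u :: cancel1 w'
      | [::] => [:: u]
      end
  end.

(* recursive cancellation of RA factors, giving A^alpha R^beta *)
Definition reduce_word (w : seq letter) : seq letter := iter (size w) cancel1 w.

Definition good_node (e : nat) (c : int * int) (mu : seq nat * seq nat) (i : nat)
  : option node :=
  let As := [seq u.2 | u <- reduce_word (iword e c mu i) & u.1] in
  if As is x :: _ then Some (last x As) else None.

Definition add_row (p : seq nat) (a : nat) : seq nat :=
  set_nth 0 p a.-1 (nth 0 p a.-1).+1.

Definition add_node (mu : seq nat * seq nat) (x : node) : seq nat * seq nat :=
  if ncomp x == 1 then (add_row mu.1 (nrow x), mu.2)
  else (mu.1, add_row mu.2 (nrow x)).

Definition crystal_edge (e : nat) (c : int * int) (mu : seq nat * seq nat) (i : nat)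
  (nu : seq nat * seq nat) : Prop :=
  exists x, good_node e c mu i = Some x /\ nu = add_node mu x.

Definition highest_weight (e : nat) (c : int * int) (mu : seq nat * seq nat) : Prop :=
  forall (nu : seq nat * seq nat) (i : nat),
    is_bipartition nu -> i < e -> ~ crystal_edge e c nu i mu.

Definition charge (e t : nat) : int * int :=
  ((Posz t - Posz (e.-1)./2)%R, 0%R).

(* Main.v *)
(** If after cancellation an i-word still contains an R, turning the leftmost
    surviving R into an A gives the i-word of a bipartition whose good addable
    node is the removed one. So at a highest weight vertex there are, for each
    residue i, at most as many removable as addable i-nodes.

    Let B be a beta-set of lambda of odd size. Adding a node to mu moves a bead of
    B from x to x + 2, and the charge is such that the content of that node modulo e
    is an affine function of x modulo e with slope 1/2, the same for both
    components. Cancelling the contributions of pairs of beads x, x + 2 in B, the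
    inequality becomes M(k + 2) <= M(k), up to a correction for the beads 0 and 1,
    where M(k) is the number of beads congruent to k modulo e. The e-core of lambda
    has the beads k + e j with j < M(k); the inequalities say that this set is
    stable under x -> x - 2 as long as x >= 2, that is, the e-core is a 2-core. *)

Require Import Defs.
From mathcomp Require Import all_boot all_order all_algebra ssrint intdiv zify.
Set Implicit Arguments. Unset Strict Implicit. Unset Printing Implicit Defensive.
Import GRing.Theory Num.Theory.

(** * Cancellation in words of addable and removable letters *)

(* [pend n w] is the number of uncancelled R's after reading [w] with [n] R's
   pending on its left. *)
Definition pend_step (n : nat) (u : letter) : nat := if u.1 then n.-1 else n.+1.
Definition pend : nat -> seq letter -> nat := foldl pend_step.

(* Every A of [w] is cancelled by an R of [w] or by one of [n] R's pending on its
   left. *)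
Fixpoint absorbed (n : nat) (w : seq letter) : bool :=
  if w is u :: w' then (~~ u.1 || (0 < n)) && absorbed (pend_step n u) w'
  else true.

(** [cancel1] looks at two letters at a time, so plain induction on the word does not follow it;
    this is induction along its run. *)
Lemma cancel1_ind (P : seq letter -> seq letter -> Prop) :
  P [::] [::] -> (forall u : letter, P [:: u] [:: u]) ->
  (forall (u v : letter) w, ~~ u.1 -> v.1 -> P [:: u, v & w] w) ->
  (forall (u v : letter) w, ~~ (~~ u.1 && v.1) -> P (v :: w) (cancel1 (v :: w)) ->
     P [:: u, v & w] (u :: cancel1 (v :: w))) ->
  forall w, P w (cancel1 w).
Proof.
move=> P0 P1 Pc Ps; elim=> [//|u [|v w] IH] //.
rewrite [cancel1 _]/=; case: ifP => [/andP[ru av]|/negbT nr]; first exact: Pc.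
exact: Ps.
Qed.

Lemma absorbed_cancel1 n w : absorbed n w -> absorbed n (cancel1 w).
Proof.
move: w n; apply: (cancel1_ind
  (P := fun w w' => forall n, absorbed n w -> absorbed n w'))
  => // [u v w nu av n|u v w _ IH n].
  by rewrite /= /pend_step av (negbTE nu).
by case/andP=> un aw; apply/andP; split=> //; apply: IH.
Qed.

(** Every A of [w] already finds an R, so one more R pending on the left is left over at the end. *)
Lemma pend_absorbed n w : absorbed n w -> pend n.+1 w = (pend n w).+1.
Proof.
elim: w n => //= u w IH n /andP[un /IH]; rewrite /pend /= => <-.
by congr foldl; move: un; rewrite /pend_step; case: u.1 => //=; case: n.
Qed.

Lemma absorbed_rcons n w u :
  absorbed n (rcons w u) = absorbed n w && (~~ u.1 || (0 < pend n w)).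
Proof. by elim: w n => /= [n|v w IH n]; rewrite ?andbT // IH andbA. Qed.

(** An A lowers the pending number by one, except when it is already 0: hence an inequality. *)
Lemma count_pend n w :
  count (fun u => ~~ u.1) w + n <= count (fun u : letter => u.1) w + pend n w.
Proof.
elim: w n => //= u w IH n; move: (IH (pend_step n u)).
rewrite /pend /= /pend_step; case: u.1 => /=; lia.
Qed.

(* The [x] found here is the leftmost R that survives cancellation. *)
Lemma leftmost_uncancelled w : 0 < pend 0 w ->
  exists p x q, [/\ w = p ++ (false, x) :: q, pend 0 p = 0 & absorbed 0 q].
Proof.
elim/last_ind: w => // w u IH; rewrite /pend foldl_rcons -/(pend 0 w).
case: u => [[] x]; rewrite /pend_step /=.
(* At least two R's are pending before this last A, so [q] can supply one and the leftmost survivor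
   stays the same. *)
- move=> w2; case: IH => [|p [y [q [def_w p0 q0]]]]; first by lia.
  exists p, y, (rcons q (true, x)).
  split; rewrite // ?absorbed_rcons ?q0 ?def_w ?rcons_cat //=.
  move: w2; rewrite def_w /pend foldl_cat -/(pend 0 p) p0 /=.
  by rewrite -/(pend 1 q) pend_absorbed.
- move=> _; case: (posnP (pend 0 w)) => [w0|/IH [p [y [q [-> p0 q0]]]]].
    by exists w, x, [::]; rewrite -cats1.
  exists p, y, (rcons q (false, x)).
  by rewrite absorbed_rcons q0 rcons_cat.
Qed.

(** The marked A meets no pending R, so a pass cannot remove it, and both conditions on its
    surroundings persist. The general [n] serves the induction on [p]. *)
Lemma cancel1_split n p x q : pend n p = 0 -> absorbed 0 q ->
  exists p' q', [/\ cancel1 (p ++ (true, x) :: q) = p' ++ (true, x) :: q',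
                    pend n p' = 0 & absorbed 0 q'].
Proof.
elim: p n => [|u [|v p] IH] n p0 q0.
- exists [::], (cancel1 q); split=> //; last exact: absorbed_cancel1.
  by case: q {q0}.
(* An R just before the marked A would still be pending, against [p0]. *)
- case: u p0 IH => [[] y] // p0 IH.
  have [||p' [q' [def p'0 q'0]]] := IH (pend_step n (true, y)) => //.
  by exists ((true, y) :: p'), q'; split=> //=; rewrite -def.
- rewrite [cancel1 _]/=; case: ifP => [/andP[nu av]|_].
    exists p, q; split=> //; move: p0.
    by rewrite /pend /= /pend_step av (negbTE nu).
  have [||p' [q' [def p'0 q'0]]] := IH (pend_step n u) => //.
  by exists (u :: p'), q'; split=> //; move: def => /= ->.
Qed.

Lemma iter_cancel1_split k p x q : pend 0 p = 0 -> absorbed 0 q ->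
  exists p' q', iter k cancel1 (p ++ (true, x) :: q) = p' ++ (true, x) :: q'
                /\ absorbed 0 q'.
Proof.
move=> p0 q0; suff [p' [q' [-> _ q'0]]] : exists p' q',
  [/\ iter k cancel1 (p ++ (true, x) :: q) = p' ++ (true, x) :: q',
      pend 0 p' = 0 & absorbed 0 q'] by exists p', q'.
elim: k => [|k [p' [q' [/= -> p'0 q'0]]]]; first by exists p, q.
exact: cancel1_split.
Qed.

Lemma size_cancel1 w : cancel1 w = w \/ size (cancel1 w) < size w.
Proof.
move: w; apply: (cancel1_ind (P := fun w w' => w' = w \/ size w' < size w))
  => [|u|u v w _ _|u v w _ [->|]]; try by left.
  by right; rewrite /=; lia.
by right.
Qed.

(** A pass that changes the word shortens it, so as many passes as there are letters reach a fixed
    point. *)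
Lemma cancel1_reduce w : cancel1 (reduce_word w) = reduce_word w.
Proof.
suff iterK n v : size v <= n ->
  cancel1 (iter n cancel1 v) = iter n cancel1 v by exact: iterK.
elim: n v => [|n IH] {}w; first by case: w.
case: (size_cancel1 w) => [fixw _|sz_w sz_n].
  suff -> : forall k, iter k cancel1 w = w by [].
  by elim=> //= k ->.
by rewrite iterSr IH //; lia.
Qed.

(** A word without a factor RA has the form A^alpha R^beta; [sorted] expresses this on adjacent
    letters. *)
Lemma cancel1_fixed w : cancel1 w = w ->
  sorted (fun u v : letter => u.1 || ~~ v.1) w.
Proof.
elim: w => // u [|v w] IH //; rewrite [cancel1 _]/=.
case: ifP => [_ /(congr1 size)/=|]; first by lia.
move=> nr [/IH sw]; rewrite /= in sw *; rewrite sw andbT.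
by move: nr; case: u.1; case: v.1.
Qed.

(** With nothing pending, [q] cannot begin with an A; after an initial R, irreducibility allows only
    R's. *)
Lemma absorbed_irreducible q : sorted (fun u v : letter => u.1 || ~~ v.1) q ->
  absorbed 0 q -> [seq u.2 | u <- q & u.1] = [::].
Proof.
case: q => //= u q; rewrite orbF; case: u => -[] x //= srt _.
elim: q x srt => //= -[[] y] q IH x //= /IH; exact.
Qed.

(** Once the leftmost surviving R is turned into an A, this identifies it as the rightmost surviving
    A, that is, the good addable node. *)
Lemma last_addable_reduce p x q : pend 0 p = 0 -> absorbed 0 q ->
  exists s, [seq u.2 | u <- reduce_word (p ++ (true, x) :: q) & u.1]
            = rcons s x.
Proof.
move=> p0 q0.
have := cancel1_reduce (p ++ (true, x) :: q); rewrite /reduce_word.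
have [p' [q' [-> q'0]]] := iter_cancel1_split
  (size (p ++ (true, x) :: q)) x p0 q0.
move=> /cancel1_fixed srt; exists [seq u.2 | u <- p' & u.1].
have [_ /path_sorted srt'] := cat_sorted2 srt.
by rewrite filter_cat map_cat /= (absorbed_irreducible srt') ?cats1.
Qed.

(** * Partitions and their boundary nodes *)

Lemma geq_trans : transitive geq.
Proof. by move=> y x z /= xy yz; apply: leq_trans yz xy. Qed.

Lemma geq_total : total geq.
Proof. by move=> x y; exact: leq_total. Qed.

Lemma geq_anti : antisymmetric geq.
Proof. by move=> x y; rewrite /= andbC => /anti_leq. Qed.

Lemma sorted_geqP l :
  reflect (forall k, nth 0 l k.+1 <= nth 0 l k) (sorted geq l).
Proof.
apply: (iffP (sortedP 0)) => H k; last by move=> _; exact: H.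
by case: (ltnP k.+1 (size l)) => [/H //|sz]; rewrite nth_default.
Qed.

Lemma nth_nonincr l : sorted geq l -> forall j k, j <= k -> nth 0 l k <= nth 0 l j.
Proof.
move=> /sorted_geqP H j k /subnK <-.
by elim: (k - j) => // n IH; rewrite addSn (leq_trans (H _)).
Qed.

(** The zeros of a nonincreasing sequence stand at its end, where the default value of [nth]
    replaces them. *)
Lemma nth_filter_pos l k : sorted geq l ->
  nth 0 [seq x <- l | 0 < x] k = nth 0 l k.
Proof.
elim: l k => //= x l IH k pl; have sl := path_sorted pl.
case: (posnP x) => [x0|x1] /=; last by case: k => //= k; exact: IH.
have l0 : all (fun y => y == 0) l.
  apply/allP => y yl; have := order_path_min geq_trans pl.
  by move=> /allP/(_ _ yl) /=; lia.
have -> : [seq y <- l | 0 < y] = [::].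
  apply/eqP; rewrite -size_eq0 size_filter -leqn0 leqNgt -has_count -all_predC.
  by apply: sub_all l0 => y /=; lia.
rewrite nth_nil; case: k => [|k] //=.
case: (ltnP k (size l)) => kl; last by rewrite nth_default.
by move/allP: l0 => /(_ _ (mem_nth 0 kl)) /eqP.
Qed.

Lemma partition_filter_pos l : sorted geq l -> is_partition [seq x <- l | 0 < x].
Proof.
move=> sl; rewrite /is_partition (sorted_filter geq_trans) //=.
exact: filter_all.
Qed.

Lemma partition_sorted l : is_partition l -> sorted geq l.
Proof. by case/andP. Qed.

Lemma nth_gt0 l k : is_partition l -> (0 < nth 0 l k) = (k < size l).
Proof.
case/andP=> _ /allP pos; case: (ltnP k) => [kl|lk].
  exact/pos/mem_nth.
by rewrite nth_default.
Qed.

Lemma partition_eq l l' : is_partition l -> is_partition l' ->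
  (forall k, nth 0 l k = nth 0 l' k) -> l = l'.
Proof.
move=> pl pl' E; have szE k : (k < size l) = (k < size l').
  by rewrite -!nth_gt0 // E.
have sz : size l = size l'.
  by have := szE (size l); have := szE (size l'); lia.
by apply: (eq_from_nth (x0 := 0)) => // k _.
Qed.

Definition comp_of (mu : seq nat * seq nat) (j : nat) : seq nat :=
  if j == 1 then mu.1 else mu.2.

(** The row needs no upper bound: the default part 0 makes the strict inequality fail below the
    first empty row. *)
Definition is_addable (mu : seq nat * seq nat) (x : node) : bool :=
  let p := comp_of mu (ncomp x) in
  [&& ncomp x \in [:: 1; 2], 0 < nrow x, ncol x == (nth 0 p (nrow x).-1).+1
    & (nrow x == 1) || (nth 0 p (nrow x).-1 < nth 0 p (nrow x).-2)].

Definition is_removable (mu : seq nat * seq nat) (x : node) : bool :=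
  let p := comp_of mu (ncomp x) in
  [&& ncomp x \in [:: 1; 2], 0 < nrow x, ncol x == nth 0 p (nrow x).-1
    & nth 0 p (nrow x) < nth 0 p (nrow x).-1].

Lemma mem_addables_comp p j x : x \in addables p j =
  [&& ncomp x == j, 0 < nrow x, ncol x == (nth 0 p (nrow x).-1).+1
    & (nrow x == 1) || (nth 0 p (nrow x).-1 < nth 0 p (nrow x).-2)].
Proof.
case: x => [[a b] k]; rewrite /nrow /ncol /ncomp /=.
apply/mapP/and4P => [[a' + [-> -> ->]]|[/eqP-> a0 /eqP-> aP]].
  by rewrite mem_filter mem_iota => /andP[-> /andP[-> _]].
exists a => //; rewrite mem_filter mem_iota aP a0 /=.
case/orP: aP => [/eqP->//|aP]; rewrite add1n !ltnS leqNgt; apply/negP => sz.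
by move: aP; rewrite (nth_default _ (n := a.-2)) //; lia.
Qed.

Lemma mem_removables_comp p j x : x \in removables p j =
  [&& ncomp x == j, 0 < nrow x, ncol x == nth 0 p (nrow x).-1
    & nth 0 p (nrow x) < nth 0 p (nrow x).-1].
Proof.
case: x => [[a b] k]; rewrite /nrow /ncol /ncomp /=.
apply/mapP/and4P => [[a' + [-> -> ->]]|[/eqP-> a0 /eqP-> aP]].
  by rewrite mem_filter mem_iota => /andP[-> /andP[-> _]].
exists a => //; rewrite mem_filter mem_iota aP a0 /=.
rewrite add1n ltnS leqNgt; apply/negP => sz.
by move: aP; rewrite (nth_default _ (n := a.-1)) //; lia.
Qed.

Lemma mem_addables mu x :
  (x \in addables mu.1 1 ++ addables mu.2 2) = is_addable mu x.
Proof.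
rewrite mem_cat !mem_addables_comp /is_addable /comp_of !inE.
case: eqP => [->|_] //=; by rewrite orbF.
Qed.

Lemma mem_removables mu x :
  (x \in removables mu.1 1 ++ removables mu.2 2) = is_removable mu x.
Proof.
rewrite mem_cat !mem_removables_comp /is_removable /comp_of !inE.
case: eqP => [->|_] //=; by rewrite orbF.
Qed.

Lemma uniq_addables mu : uniq (addables mu.1 1 ++ addables mu.2 2).
Proof.
have U p j : uniq (addables p j).
  by rewrite map_inj_uniq ?filter_uniq ?iota_uniq // => a b [].
rewrite cat_uniq !U andbT andTb; apply/hasPn => x.
by rewrite !mem_addables_comp => /and4P[/eqP->].
Qed.

Lemma uniq_removables mu : uniq (removables mu.1 1 ++ removables mu.2 2).
Proof.
have U p j : uniq (removables p j).
  by rewrite map_inj_uniq ?filter_uniq ?iota_uniq // => a b [].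
rewrite cat_uniq !U andbT andTb; apply/hasPn => x.
by rewrite !mem_removables_comp => /and4P[/eqP->].
Qed.

(** * Letters and their order in the i-words *)

Definition letters (mu : seq nat * seq nat) : seq letter :=
  [seq (true, x) | x <- addables mu.1 1 ++ addables mu.2 2] ++
  [seq (false, x) | x <- removables mu.1 1 ++ removables mu.2 2].

Lemma mem_letters mu u : u \in letters mu =
  if u.1 then is_addable mu u.2 else is_removable mu u.2.
Proof.
case: u => b x; rewrite mem_cat -mem_addables -mem_removables.
move: (_ ++ _) (_ ++ _) => As Rs /=.
have inj b' : injective (fun x : node => (b', x)) by move=> ? ? [].
case: b; [rewrite (mem_map (inj _ true))|rewrite (mem_map (inj _ false))].
  by rewrite [X in _ || X](_ : _ = false) ?orbF //; apply/mapP => -[].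
by rewrite [X in X || _](_ : _ = false) //; apply/mapP => -[].
Qed.

Lemma uniq_letters mu : uniq (letters mu).
Proof.
rewrite cat_uniq !map_inj_uniq ?uniq_addables ?uniq_removables ?andbT ?andTb;
  try by move=> ? ? [].
by apply/hasPn => u /mapP[x _ ->]; apply/mapP => -[].
Qed.

Lemma iwordE e c mu i :
  iword e c mu i = sort (letter_le c) [seq u <- letters mu | has_residue e c i u.2].
Proof. by []. Qed.

Lemma mem_iword e c mu i u : u \in iword e c mu i =
  has_residue e c i u.2 &&
  (if u.1 then is_addable mu u.2 else is_removable mu u.2).
Proof. by rewrite iwordE mem_sort mem_filter mem_letters. Qed.

Lemma uniq_iword e c mu i : uniq (iword e c mu i).
Proof. by rewrite iwordE sort_uniq filter_uniq ?uniq_letters. Qed.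

Lemma letter_le_total c : total (letter_le c).
Proof.
by move=> u v; rewrite /letter_le; lia.
Qed.

Lemma letter_le_trans c : transitive (letter_le c).
Proof.
move=> v u w; rewrite /letter_le; lia.
Qed.

Lemma letter_le_anti c u v : letter_le c u v -> letter_le c v u ->
  content c u.2 = content c v.2 /\ ncomp u.2 = ncomp v.2.
Proof. rewrite /letter_le; lia. Qed.

Lemma sorted_iword e c mu i : sorted (letter_le c) (iword e c mu i).
Proof. exact/sort_sorted/letter_le_total. Qed.

Lemma comp_of_sorted mu j : is_bipartition mu -> sorted geq (comp_of mu j).
Proof.
by case/andP=> /partition_sorted ? /partition_sorted ?; rewrite /comp_of; case: ifP.
Qed.

(** Along the boundary of one Young diagram, addable and removable nodes lie on pairwise distinct
    diagonals. Hence the order on letters is antisymmetric on those of a bipartition. *)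
Lemma letters_inj c mu u v : is_bipartition mu ->
  u \in letters mu -> v \in letters mu ->
  content c u.2 = content c v.2 -> ncomp u.2 = ncomp v.2 -> u = v.
Proof.
move=> bmu; rewrite !mem_letters.
case: u => f [[a b] j]; case: v => g [[a' b'] j'].
rewrite /is_addable /is_removable /content /nrow /ncol /ncomp /=.
move=> uP vP cE jE; rewrite -{j'}jE in vP cE *.
move: uP vP; have := nth_nonincr (comp_of_sorted j bmu).
move: (comp_of mu j) => p dec.
have cE' : (Posz b - Posz a)%R = (Posz b' - Posz a')%R by lia.
move=> {cE}.
case: f; case: g => /and4P[_ a0 /eqP b_def aP] /and4P[_ a'0 /eqP b'_def a'P].
- suff aa : a = a' by rewrite aa in b_def *; rewrite b_def b'_def.
  by case: (ltngtP a a') => // aa;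
    [have := dec a.-1 a'.-1 | have := dec a'.-1 a.-1]; clear dec; lia.
- by exfalso; case: (ltnP a' a) => aa;
    [have := dec a' a.-1 | have := dec a.-1 a'.-1]; clear dec; lia.
- by exfalso; case: (ltnP a a') => aa;
    [have := dec a a'.-1 | have := dec a'.-1 a.-1]; clear dec; lia.
- suff aa : a = a' by rewrite aa in b_def *; rewrite b_def b'_def.
  by case: (ltngtP a a') => // aa;
    [have := dec a.-1 a'.-1 | have := dec a'.-1 a.-1]; clear dec; lia.
Qed.

(** * Removing a good node *)

(** The filter drops the part 0 that appears when a row of length one is emptied. *)
Definition rem_row (p : seq nat) (a : nat) : seq nat :=
  [seq x <- set_nth 0 p a.-1 (nth 0 p a.-1).-1 | 0 < x].

Definition rem_node (mu : seq nat * seq nat) (x : node) : seq nat * seq nat :=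
  if ncomp x == 1 then (rem_row mu.1 (nrow x), mu.2)
  else (mu.1, rem_row mu.2 (nrow x)).

Lemma sorted_rem_row p a : sorted geq p -> nth 0 p a < nth 0 p a.-1 ->
  sorted geq (set_nth 0 p a.-1 (nth 0 p a.-1).-1).
Proof.
case: a => [|a] sp; rewrite /= ?ltnn // => ra.
apply/sorted_geqP => k; rewrite !nth_set_nth /=.
have := sorted_geqP _ sp k; case: eqP => [<-|_]; case: eqP => [ka|_] //; try lia.
by rewrite ka; lia.
Qed.

Lemma nth_rem_row p a k : sorted geq p -> nth 0 p a < nth 0 p a.-1 ->
  nth 0 (rem_row p a) k = if k == a.-1 then (nth 0 p a.-1).-1 else nth 0 p k.
Proof.
by move=> sp ra; rewrite nth_filter_pos ?nth_set_nth // sorted_rem_row.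
Qed.

Lemma partition_rem_row p a : is_partition p -> nth 0 p a < nth 0 p a.-1 ->
  is_partition (rem_row p a).
Proof.
by move=> pp ra; apply/partition_filter_pos/sorted_rem_row; case/andP: pp.
Qed.

Lemma add_rem_row p a : is_partition p -> 0 < a -> nth 0 p a < nth 0 p a.-1 ->
  add_row (rem_row p a) a = p.
Proof.
move=> pp a0 ra; have sp := partition_sorted pp.
have nthE k : nth 0 (add_row (rem_row p a) a) k = nth 0 p k.
  by rewrite nth_set_nth /= !nth_rem_row // eqxx; case: eqP => // ->; lia.
have szp : a.-1 < size p by rewrite -nth_gt0 //; lia.
(* [nth] does not see trailing zeros, so the sizes have to be compared as well. *)
have szE k : (k < size (add_row (rem_row p a) a)) = (k < size p).
  rewrite size_set_nth leq_max -(nth_gt0 _ (partition_rem_row pp ra)).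
  rewrite nth_rem_row // -!nth_gt0 //; case: eqP => [->|ka] //; first by lia.
  case: (ltnP k a.-1.+1) => //= ka'.
  by rewrite nth_gt0 //; lia.
apply: (eq_from_nth (x0 := 0)) => //.
by have := szE (size p); have := szE (size (add_row (rem_row p a) a)); lia.
Qed.

Lemma rem_node_bipartition mu x : is_bipartition mu -> is_removable mu x ->
  is_bipartition (rem_node mu x).
Proof.
case/andP=> p1 p2 /and4P[_ _ _]; rewrite /is_bipartition /rem_node /comp_of.
by case: ifP => _ rx; rewrite /= ?p1 ?p2 ?andbT ?partition_rem_row.
Qed.

Lemma add_rem_node mu x : is_bipartition mu -> is_removable mu x ->
  add_node (rem_node mu x) x = mu.
Proof.
case: mu => m1 m2 /andP[/= p1 p2] /and4P[_ x0 _].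
rewrite /add_node /rem_node /comp_of /=.
by case: ifP => _ rx /=; rewrite add_rem_row.
Qed.

Lemma nth_comp_rem_node mu x j k : is_bipartition mu -> is_removable mu x ->
  nth 0 (comp_of (rem_node mu x) j) k =
  if ((j == 1) == (ncomp x == 1)) && (k == (nrow x).-1)
  then (ncol x).-1 else nth 0 (comp_of mu j) k.
Proof.
move=> bmu /and4P[_ x0 /eqP -> rx]; move: (comp_of_sorted (ncomp x) bmu) rx.
rewrite /comp_of /rem_node.
by case: (ncomp x == 1) => sp rx; case: (j == 1); rewrite /= ?nth_rem_row.
Qed.

Lemma residue_shift e c i x y : 1 < e -> has_residue e c i x ->
  has_residue e c i y ->
  ~ (content c y = content c x + 1 \/ content c y = content c x - 1)%R.
Proof.
move=> e1 /eqP xi /eqP yi yE.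
have : (Posz e %| (content c y - content c x)%R)%Z.
  by rewrite -eqz_mod_dvd xi yi.
have [->|->] : (content c y - content c x = 1 \/
                content c y - content c x = -1)%R by lia.
  by rewrite dvdzE /= dvdn1; lia.
by rewrite dvdzE /= dvdn1; lia.
Qed.

(** Besides [x] itself, only the nodes right of [x] and below [x] can change status. Their contents
    differ by one from that of [x], so [residue_shift] excludes them. *)
Lemma is_addable_rem_node e c i mu x y : 1 < e ->
  is_bipartition mu -> is_removable mu x ->
  has_residue e c i x -> has_residue e c i y ->
  is_addable (rem_node mu x) y = is_addable mu y || (y == x).
Proof.
move=> e1 bmu rx xi yi; have := residue_shift e1 xi yi.
rewrite /is_addable !nth_comp_rem_node //.
have /and4P[x12 x0 /eqP xE rx'] := rx.
have := nth_nonincr (comp_of_sorted (ncomp x) bmu).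
clear yi xi; case: x rx x12 x0 xE rx' => [[a b] j] rx.
case: y => [[a' b'] j']; rewrite /content /nrow /ncol /ncomp /= !xpair_eqE.
move=> j12 a0 b_def ra dec; rewrite !inE in j12 *.
case: (posnP a') => [->|a'0] /=.
  have -> : (0 == a) = false by lia.
  by move=> _; rewrite !andbF.
case: (eqVneq j' j) => [->|jj'].
- rewrite ?j12 !eqxx /= => cy.
  have dec2 := dec a.-2 a.-1.
  case: (ltngtP a' a) => aa.
  + have -> : (a'.-1 == a.-1) = false by lia.
    have -> : (a'.-2 == a.-1) = false by lia.
    by rewrite orbF.
  + have -> : (a'.-1 == a.-1) = false by lia.
    case: (eqVneq a'.-2 a.-1) => [E|]; last by rewrite orbF.
    have E' : a'.-1 = a by lia.
    rewrite E' -b_def in ra *; clear dec dec2 rx bmu.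
    by move: (nth _ _ a) ra cy => z; case: (j == 1); lia.
  + subst a'; rewrite eqxx -b_def; move: cy.
    have -> : (a.-2 == a.-1) = (a == 1) by lia.
    clear dec; rewrite -b_def in ra dec2.
    move: (nth _ _ a) ra; move: (nth _ _ a.-2) dec2 => y dec2 z.
    by case: (eqVneq a 1); case: (j == 1); lia.
- move=> _; rewrite andbF orbF.
  case j'12: ((j' == 1) || (j' == 2)) => //=.
  by have -> : (j' == 1) == (j == 1) = false by lia.
Qed.

(** Only the nodes left of [x] and above [x] can become removable, and their contents again differ
    by one from that of [x]. *)
Lemma is_removable_rem_node e c i mu x y : 1 < e ->
  is_bipartition mu -> is_removable mu x ->
  has_residue e c i x -> has_residue e c i y ->
  is_removable (rem_node mu x) y = is_removable mu y && (y != x).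
Proof.
move=> e1 bmu rx xi yi; have := residue_shift e1 xi yi.
rewrite /is_removable !nth_comp_rem_node //.
have /and4P[x12 x0 /eqP xE rx'] := rx.
have := nth_nonincr (comp_of_sorted (ncomp x) bmu).
clear yi xi; case: x rx x12 x0 xE rx' => [[a b] j] rx.
case: y => [[a' b'] j']; rewrite /content /nrow /ncol /ncomp /= !xpair_eqE.
move=> j12 a0 b_def ra dec; rewrite !inE in j12 *.
case: (posnP a') => [->|a'0] /=; first by rewrite !andbF.
case: (eqVneq j' j) => [->|jj'].
- rewrite ?j12 !eqxx /= => cy.
  have dec2 := dec a.-2 a.-1.
  case: (ltngtP a' a) => aa.
  + have -> : (a'.-1 == a.-1) = false by lia.
    case: (eqVneq a' a.-1) => [E|]; last by rewrite /= ?andbT.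
    rewrite E -b_def in cy *; clear dec rx bmu; move: cy.
    by move: (nth _ _ a.-2) dec2 => z; case: (j == 1); lia.
  + have -> : (a'.-1 == a.-1) = false by lia.
    have -> : (a' == a.-1) = false by lia.
    by rewrite /= ?andbT.
  + subst a'; rewrite eqxx -b_def; move: cy.
    have -> : (a == a.-1) = false by lia.
    clear dec; rewrite -b_def in ra dec2.
    move: (nth _ _ a) ra => z.
    by case: (j == 1); lia.
- move=> _; rewrite !andbF andbT.
  case j'12: ((j' == 1) || (j' == 2)) => //=.
  by have -> : (j' == 1) == (j == 1) = false by lia.
Qed.

(** By [letters_inj] a sorted i-word is determined by its set of letters, and in this set only the
    type of [x] changes. *)
Lemma iword_rem_node e c mu i x w1 w2 : 1 < e -> is_bipartition mu ->
  iword e c mu i = w1 ++ (false, x) :: w2 ->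
  iword e c (rem_node mu x) i = w1 ++ (true, x) :: w2.
Proof.
move=> e1 bmu def_w.
have /andP[xi rx] : has_residue e c i x && is_removable mu x.
  have : (false, x) \in iword e c mu i by rewrite def_w mem_cat inE eqxx orbT.
  by rewrite mem_iword.
have nax : ~~ is_addable mu x.
  apply/negP => ax; have := @letters_inj c mu (true, x) (false, x) bmu.
  by rewrite !mem_letters => /(_ ax rx erefl erefl).
have tx : (true, x) \notin iword e c mu i.
  by rewrite mem_iword /= (negbTE nax) andbF.
have pm b : perm_eq (w1 ++ (b, x) :: w2) ((b, x) :: w1 ++ w2).
  by rewrite -cat1s perm_catCA.
have := uniq_iword e c mu i; rewrite def_w (perm_uniq (pm false)) /=.
case/andP=> fx12 u12.
have tx12 : (true, x) \notin w1 ++ w2.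
  by apply: contra tx => tx; rewrite def_w (perm_mem (pm false)) inE tx orbT.
have mem12 u : u \in w1 ++ w2 = (u \in iword e c mu i) && (u != (false, x)).
  rewrite def_w (perm_mem (pm false)) inE.
  by case: eqVneq => [->|]; rewrite ?andbT ?andbF ?(negbTE fx12).
apply: (@sorted_eq_in _ (letter_le c)); last 1 first.
- rewrite perm_sym (permPl (pm true)) perm_sym; apply: uniq_perm => [||u].
  + exact: uniq_iword.
  + by rewrite /= tx12.
  rewrite inE mem12 !mem_iword.
  case: (boolP (has_residue e c i u.2)) => ui /=; last first.
    by rewrite orbF; symmetry; apply/negbTE; apply: contra ui => /eqP ->.
  case: u ui => -[] y yi /=.
    by rewrite (is_addable_rem_node e1 bmu rx xi yi) !xpair_eqE /= andbT orbC.
  by rewrite (is_removable_rem_node e1 bmu rx xi yi) !xpair_eqE.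
- by move=> u v w _ _ _; exact: letter_le_trans.
- move=> u v; rewrite !mem_iword -!mem_letters => /andP[_ lu] /andP[_ lv].
  case/andP=> uv vu; have [cE jE] := letter_le_anti uv vu.
  by apply: (letters_inj _ lu lv cE jE); apply: rem_node_bipartition.
- exact: sorted_iword.
- have := sorted_iword e c mu i; rewrite def_w.
  (* The order looks only at nodes, so changing the type of a letter keeps the word sorted. *)
  have -> : letter_le c = relpre snd (fun y z : node =>
    (content c y < content c z)%R ||
    ((content c y == content c z) && (ncomp z <= ncomp y))) by [].
  by rewrite -!sorted_map !map_cat.
Qed.

Lemma highest_weight_count e c mu i : 1 < e -> i < e -> is_bipartition mu ->
  highest_weight e c mu ->
  count (fun u => has_residue e c i u.2 && ~~ u.1) (letters mu)
  <= count (fun u => has_residue e c i u.2 && u.1) (letters mu).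
Proof.
move=> e1 ie bmu hw.
suff: count (fun u => ~~ u.1) (iword e c mu i)
      <= count (fun u : letter => u.1) (iword e c mu i).
  rewrite iwordE !count_sort !count_filter.
  under eq_count do rewrite /= andbC.
  by under [X in _ <= X -> _]eq_count do rewrite /= andbC.
have := count_pend 0 (iword e c mu i); rewrite addn0.
case: (posnP (pend 0 (iword e c mu i))) => [->|/leftmost_uncancelled].
  by rewrite addn0.
case=> p [x [q [def_w p0 q0]]]; exfalso.
have rx : is_removable mu x.
  have : (false, x) \in iword e c mu i by rewrite def_w mem_cat inE eqxx orbT.
  by rewrite mem_iword => /andP[].
apply: (hw (rem_node mu x) i) => //; first exact: rem_node_bipartition.
exists x; rewrite add_rem_node //; split=> //.
rewrite /good_node (iword_rem_node e1 bmu def_w).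
have [s ->] := last_addable_reduce x p0 q0.
by case: s => [|y s] //=; rewrite last_rcons.
Qed.

(** * Beta-sets and cores *)

Lemma size_betaset r l : size (betaset r l) = r.
Proof. by rewrite size_map size_iota. Qed.

Lemma nth_betaset r l k : k < r -> nth 0 (betaset r l) k = nth 0 l k + (r - k.+1).
Proof.
move=> kr; rewrite (nth_map 0) ?size_iota // nth_iota // add1n /=.
by rewrite addnBA.
Qed.

Lemma betaset_decr r l : sorted geq l -> sorted gtn (betaset r l).
Proof.
move=> sl; apply/(sortedP 0) => k; rewrite size_betaset => kr.
rewrite /= !nth_betaset ?(ltnW kr) //.
by have := sorted_geqP _ sl k; lia.
Qed.

Lemma gtn_sorted_geq s : sorted gtn s -> sorted geq s.
Proof. by apply: sub_sorted => x y; exact: ltnW. Qed.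

Lemma betaset_sorted r l : sorted geq l -> sorted geq (betaset r l).
Proof. by move/(betaset_decr r)/gtn_sorted_geq. Qed.

Lemma gtn_trans : transitive gtn.
Proof. by move=> y x z /= xy yz; exact: ltn_trans yz xy. Qed.

Lemma betaset_uniq r l : sorted geq l -> uniq (betaset r l).
Proof.
move=> /(betaset_decr r); apply: sorted_uniq gtn_trans _ _ => x.
exact: ltnn.
Qed.

Lemma sort_geq_decr X : uniq X -> sorted gtn (sort geq X).
Proof.
move=> uX; have: pairwise geq (sort geq X).
  by rewrite -sorted_pairwise ?(sort_sorted geq_total) //; exact: geq_trans.
have: uniq (sort geq X) by rewrite sort_uniq.
rewrite uniq_pairwise (sorted_pairwise gtn_trans) => un ge.
have: pairwise [rel x y | (x != y) && geq x y] (sort geq X).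
  by rewrite pairwise_relI un.
by apply: sub_pairwise => x y /=; rewrite ltn_neqAle eq_sym.
Qed.

(** The [size s - k.+1] entries after position [k] are distinct and smaller, so the truncated
    subtraction in [beta_parts] is exact. *)
Lemma nth_decr_ge s k : sorted gtn s -> k < size s -> size s - k.+1 <= nth 0 s k.
Proof.
elim: s k => //= x s IH [|k] ps ks.
  case: s IH ps {ks} => //= y s IH /andP[yx ps].
  by have := IH 0 ps isT; rewrite /=; lia.
by have := IH k (path_sorted ps) ks; rewrite /=; lia.
Qed.

(** This is [part_of_beta] before zeros are dropped, so that entries stay aligned with beads. *)
Definition beta_parts (X : seq nat) : seq nat :=
  [seq nth 0 (sort geq X) k - (size X - k.+1) | k <- iota 0 (size X)].

Lemma part_of_betaE X : part_of_beta X = [seq x <- beta_parts X | 0 < x].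
Proof. by rewrite /part_of_beta /beta_parts size_sort. Qed.

Lemma nth_beta_parts X k : k < size X ->
  nth 0 (beta_parts X) k = nth 0 (sort geq X) k - (size X - k.+1).
Proof. by move=> kX; rewrite (nth_map 0) ?size_iota // nth_iota. Qed.

Lemma beta_parts_sorted X : uniq X -> sorted geq (beta_parts X).
Proof.
move=> /sort_geq_decr /(sortedP 0) dX; apply/(sortedP 0) => k.
rewrite size_map size_iota => kX; rewrite /= !nth_beta_parts ?(ltnW kX) //.
by have := dX k; rewrite size_sort /= => /(_ kX); lia.
Qed.

Lemma partition_part_of_beta X : uniq X -> is_partition (part_of_beta X).
Proof.
by move=> uX; rewrite part_of_betaE partition_filter_pos ?beta_parts_sorted.
Qed.

Lemma size_part_of_beta X : size (part_of_beta X) <= size X.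
Proof.
rewrite part_of_betaE size_filter (leq_trans (count_size _ _)) //.
by rewrite size_map size_iota.
Qed.

Lemma part_of_betaK X : uniq X -> betaset (size X) (part_of_beta X) = sort geq X.
Proof.
move=> uX; apply: (eq_from_nth (x0 := 0)) => [|k].
  by rewrite size_betaset size_sort.
rewrite size_betaset => kX; rewrite nth_betaset // part_of_betaE.
rewrite nth_filter_pos ?beta_parts_sorted // nth_beta_parts // subnK //.
by have := nth_decr_ge (sort_geq_decr uX) (k := k); rewrite size_sort; apply.
Qed.

Lemma betasetK r l : is_partition l -> size l <= r ->
  part_of_beta (betaset r l) = l.
Proof.
move=> pl lr; have sl := partition_sorted pl.
apply: partition_eq => // [|k].
  exact/partition_part_of_beta/betaset_uniq.
rewrite part_of_betaE nth_filter_pos ?beta_parts_sorted ?betaset_uniq //.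
case: (ltnP k r) => kr.
  rewrite nth_beta_parts size_betaset // (sorted_sort geq_trans) ?betaset_sorted //.
  by rewrite nth_betaset ?addnK.
by rewrite !nth_default ?size_map ?size_iota // (leq_trans lr).
Qed.

Lemma part_of_beta_perm X Y : perm_eq X Y -> part_of_beta X = part_of_beta Y.
Proof.
move=> XY; rewrite /part_of_beta.
by have /perm_sortP -> := XY; [|exact: geq_total|exact: geq_trans|exact: geq_anti].
Qed.

(** The added row is empty and becomes the bead 0. This shift links statements about different
    numbers of beads. *)
Lemma betasetS r l : size l <= r ->
  betaset r.+1 l = rcons (map S (betaset r l)) 0.
Proof.
move=> lr; apply: (eq_from_nth (x0 := 0)) => [|k].
  by rewrite size_rcons size_map !size_betaset.
rewrite size_betaset ltnS => kr; rewrite nth_betaset // nth_rcons size_map.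
rewrite size_betaset; case: ltngtP kr => // [kr _|-> _].
  by rewrite (nth_map 0) ?size_betaset // nth_betaset //; lia.
by rewrite nth_default // subnn.
Qed.

Lemma mem_betasetS r l x : size l <= r ->
  (x.+1 \in betaset r.+1 l) = (x \in betaset r l).
Proof.
by move=> lr; rewrite betasetS // mem_rcons inE /= mem_map //; exact: succn_inj.
Qed.

Lemma count_betasetS (P : pred nat) r l : size l <= r ->
  count P (betaset r.+1 l) = count (P \o S) (betaset r l) + P 0.
Proof.
by move=> lr; rewrite betasetS // -cats1 count_cat count_map /= addn0.
Qed.

(** For a fixed number of beads this is an invariant of the 2-core. It is also the difference of the
    bead numbers of the two components of the 2-quotient. *)
Definition balance (X : seq nat) : int :=
  (Posz (count (predC odd) X) - Posz (count odd X))%R.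

Lemma balanceS r l : size l <= r ->
  balance (betaset r.+1 l) = (1 - balance (betaset r l))%R.
Proof.
move=> lr; rewrite /balance !count_betasetS // addn0.
have -> : count (predC odd \o S) (betaset r l) = count odd (betaset r l).
  by apply: eq_count => x /=; rewrite negbK.
have -> : count (odd \o S) (betaset r l) = count (predC odd) (betaset r l).
  exact: eq_count.
rewrite /=; lia.
Qed.

Lemma nth_staircase t k : nth 0 (staircase t) k = t - k.
Proof.
case: (ltnP k t) => kt; last first.
  by rewrite nth_default ?size_map ?size_iota //; lia.
by rewrite (nth_map 0) ?size_iota // nth_iota.
Qed.

(** With [t] beads, the beads are 1, 3, ..., 2t - 1, so the balance is -t. Each further bead
    replaces the balance b by 1 - b. *)
Lemma balance_staircase t r : t <= r ->
  balance (betaset r (staircase t))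
  = if odd (r - t) then Posz t.+1 else (- Posz t)%R.
Proof.
move=> tr; rewrite -(subnK tr) addnK; elim: (r - t) => [|d IH].
  have all_odd : all odd (betaset t (staircase t)).
    apply/(all_nthP 0) => k; rewrite size_betaset => kt.
    by rewrite nth_betaset // nth_staircase; lia.
  have := all_odd; rewrite all_count size_betaset => /eqP od.
  have := count_predC odd (betaset t (staircase t)); rewrite size_betaset add0n.
  by rewrite /balance /= od; lia.
rewrite addSn balanceS ?size_map ?size_iota ?leq_addl // IH /=.
by case: (odd d) => /=; lia.
Qed.

Definition core_beads (e : nat) (X : seq nat) : seq nat :=
  flatten [seq [seq c + e * i | i <- iota 0 (count (fun x => x %% e == c) X)]
          | c <- iota 0 e].

Lemma mem_core_beads e X x : 0 < e ->
  (x \in core_beads e X) = (x %/ e < count (fun y => y %% e == x %% e) X).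
Proof.
move=> e0; apply/flatten_mapP/idP => [[c]|lt_x].
  rewrite mem_iota /= => ce /mapP[i]; rewrite mem_iota /= => ic ->.
  by rewrite addnC mulnC modnMDl divnMDl // modn_small // divn_small // addn0.
exists (x %% e); first by rewrite mem_iota ltn_mod.
apply/mapP; exists (x %/ e); first by rewrite mem_iota.
by rewrite {1}(divn_eq x e) addnC mulnC.
Qed.

Lemma uniq_core_beads e X : 0 < e -> uniq (core_beads e X).
Proof.
move=> e0; rewrite /core_beads.
have : all (gtn e) (iota 0 e) by apply/allP => c; rewrite mem_iota.
elim: (iota 0 e) (iota_uniq 0 e) => //= c s IH /andP[cs us] /andP[ce se].
rewrite cat_uniq IH // andbT map_inj_uniq ?iota_uniq; last first.
  by move=> i j /addnI/eqP; rewrite eqn_pmul2l // => /eqP.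
apply/hasPn => x /flatten_mapP[c' c's /mapP[i _ ->]].
apply/mapP => -[j _ /(congr1 (modn^~ e))].
have c'e : c' < e by apply: (allP se).
rewrite ![_ + e * _]addnC ![e * _]mulnC !modnMDl !modn_small // => cc'.
by rewrite -cc' c's in cs.
Qed.

(** On the abacus with two runners, no bead can be slid up. *)
Definition closed2 (X : seq nat) : Prop :=
  forall x, x.+2 \in X -> x \in X.

Lemma closed2_betaset_pred r l : size l <= r ->
  closed2 (betaset r.+1 l) -> closed2 (betaset r l).
Proof.
by move=> lr cl x; rewrite -!(mem_betasetS _ lr) => /cl.
Qed.

Lemma closed2_betaset r l : size l <= r ->
  closed2 (betaset r l) -> closed2 (betaset (size l) l).
Proof.
move=> /subnK <-; elim: (r - size l) => //= d IH; rewrite addSn.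
by move/closed2_betaset_pred => /(_ (leq_addl _ _)).
Qed.

(** Each member brings in all smaller numbers, so it is less than [size s]; equal cardinality then
    makes [s] the initial segment of that length. *)
Lemma downclosed_mem s i : uniq s -> (forall j, j.+1 \in s -> j \in s) ->
  (i \in s) = (i < size s).
Proof.
move=> us dn.
have le_mem j k : k \in s -> j <= k -> j \in s.
  move=> + /subnK E; rewrite -{}E.
  by elim: (k - j) => //= d IH; rewrite addSn => /dn.
have sub : {subset s <= iota 0 (size s)}.
  move=> j js; rewrite mem_iota add0n /=.
  have := uniq_leq_size (iota_uniq 0 j.+1) (s2 := s).
  rewrite size_iota; apply=> k; rewrite mem_iota /= ltnS; exact: le_mem.
have [|_ ->] := uniq_min_size us sub; first by rewrite size_iota.
by rewrite mem_iota.
Qed.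

(** A stable set already occupies an initial segment of each of the two runners, so sliding its
    beads changes nothing. *)
Lemma core_beads2_perm X : uniq X -> closed2 X -> perm_eq (core_beads 2 X) X.
Proof.
move=> uX cX; apply: uniq_perm => //; first exact: uniq_core_beads.
move=> x; rewrite mem_core_beads // -size_filter.
have mem_half y : y %% 2 = x %% 2 ->
    (y \in X) = (y %/ 2 \in [seq z %/ 2 | z <- X & z %% 2 == x %% 2]).
  move=> yx; apply/idP/mapP => [yX|[z]].
    by exists y; rewrite // mem_filter yx eqxx.
  rewrite mem_filter => /andP[/eqP zx zX] E.
  by rewrite (divn_eq y 2) E yx -zx -divn_eq.
rewrite -(size_map (divn^~ 2)) -downclosed_mem ?mem_half //.
- rewrite map_inj_in_uniq ?filter_uniq // => y z.
  rewrite !mem_filter => /andP[/eqP yx _] /andP[/eqP zx _] E.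
  by rewrite (divn_eq y 2) E yx -zx -divn_eq.
- move=> j; have E k : k = (k * 2 + x %% 2) %/ 2 by lia.
  rewrite (E j.+1) [in X in _ -> X](E j) -!mem_half; try lia.
  have -> : j.+1 * 2 + x %% 2 = (j * 2 + x %% 2).+2 by lia.
  exact: cX.
Qed.

Lemma is_core2 X : uniq X -> closed2 X -> is_core 2 (part_of_beta X).
Proof.
move=> uX cX; have pl := partition_part_of_beta uX.
have sl := partition_sorted pl.
apply/eqP; rewrite /ecore -/(core_beads _ _).
rewrite (part_of_beta_perm (core_beads2_perm _ _)) ?betasetK ?betaset_uniq //.
(* [ecore] uses one bead per part, possibly fewer than [X] has. *)
apply: (closed2_betaset (size_part_of_beta X)).
by rewrite part_of_betaK // => x; rewrite !mem_sort; exact: cX.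
Qed.

(** * Counting boundary nodes on the abacus *)

Lemma count_iota_widen (f : pred nat) n n' : n <= n' ->
  (forall k, n <= k -> f k = false) ->
  count f (iota 0 n') = count f (iota 0 n).
Proof.
move=> nn' f0; rewrite -(subnKC nn') iotaD count_cat add0n.
rewrite (_ : count f (iota n _) = 0) ?addn0 //.
rewrite -[RHS](count_pred0 (iota n (n' - n))); apply: eq_in_count => k.
by rewrite mem_iota => /andP[/f0].
Qed.

Lemma count_iotaS (f : pred nat) n :
  count f (iota 0 n.+1) = f 0 + count (f \o S) (iota 0 n).
Proof. by rewrite /= -[1]addn0 iotaDl count_map. Qed.

Lemma count_exchange (f g f' g' : pred nat) s :
  {in s, forall k, f k + g k = f' k + g' k} ->
  count f s + count g s = count f' s + count g' s.
Proof.
elim: s => //= k s IH E; have /= := E k (mem_head k s).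
have /IH : {in s, forall k, f k + g k = f' k + g' k}.
  by move=> i si; apply: E; rewrite inE si orbT.
lia.
Qed.

(** Contents without the charge, so that one bead count serves both components. *)
Definition diag (x : node) : int := (Posz (ncol x) - Posz (nrow x))%R.

(** A row with bead y has its removable node, if any, on diagonal y - n and its addable node on y +
    1 - n. As [n] exceeds [size p], the last bead is 0 and belongs to an empty row, which [0 < y]
    discards. *)
Lemma bead_count (Q : int -> bool) p j n : size p < n ->
  is_partition p ->
  count (Q \o diag) (addables p j)
    + count (fun y => (0 < y) && Q (Posz y - Posz n)%R) (betaset n p)
  = count (Q \o diag) (removables p j)
    + count (fun y => Q (Posz y.+1 - Posz n)%R) (betaset n p).
Proof.
case: n => // m; rewrite ltnS => pm /partition_sorted/sorted_geqP dec.
have iota1 (k : nat) : iota 1 k = [seq i.+1 | i <- iota 0 k] by exact: (iotaDl 1 0).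
rewrite /addables /removables /betaset !iota1 !count_map !count_filter !count_map.
(* Rows beyond the shape carry no nodes, so both node counts may run over all beads. *)
rewrite -(@count_iota_widen _ (size p).+1 m.+1) //; last first.
  by move=> [|k] //= kp; rewrite (nth_default _ (n := k)) // andbF.
rewrite -(@count_iota_widen _ (size p) m) //; last first.
  by move=> k /= kp; rewrite (nth_default _ (n := k)) // andbF.
rewrite count_iotaS.
have -> : count (preim S (preim (fun k => nth 0 p k.-1 + m.+1 - k)
    (fun y => (0 < y) && Q (Posz y - Posz m.+1)%R))) (iota 0 m.+1)
  = count (fun k => Q (Posz (nth 0%N p k) - Posz k.+1)%R) (iota 0 m).
  have -> : iota 0 m.+1 = iota 0 m ++ [:: m] by rewrite -addn1 iotaD.
  rewrite count_cat /= addn0.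
  rewrite nth_default // subnn addn0; apply: eq_in_count => k.
  rewrite mem_iota /= => km.
  have -> : 0 < nth 0 p k + m.+1 - k.+1 by lia.
  by rewrite andTb; congr Q; lia.
rewrite [in RHS]count_iotaS -!addnA [RHS]addnCA; congr (_ + _).
  rewrite /preim /diag /ncol /nrow /= andbT; congr (nat_of_bool (Q _)).
  by rewrite addnS subn1; lia.
(* A removable node in one row is paired with an addable node in the next: both exist or neither
   does, and in the latter case the two beads are adjacent and their terms agree. *)
apply: count_exchange => k; rewrite mem_iota add0n => km.
rewrite /preim /diag /ncol /nrow /=.
have -> : (Posz (nth 0%N p k.+1 + m.+1 - k.+2).+1 - Posz m.+1
           = Posz (nth 0%N p k.+1).+1 - Posz k.+2)%R by lia.
have := dec k; rewrite leq_eqVlt => /orP[/eqP->|lt_p].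
  rewrite ltnn !andbF !add0n; congr (nat_of_bool (Q _)); lia.
rewrite lt_p !andbT addnC; congr (nat_of_bool (Q _) + _).
Qed.

(** * Bead counts modulo e *)

Definition runner (e : nat) (X : seq nat) (k : nat) : nat :=
  count (fun x => x %% e == k) X.

(* The term [e <= k + 2] accounts for the beads 0 and 1, which cannot be moved
   down by 2. *)
Definition dominant (e : nat) (X : seq nat) : Prop :=
  forall k, k < e -> runner e X ((k + 2) %% e) <= runner e X k + (e <= k + 2).

Lemma modnD_small e k d : k < e -> d <= e ->
  (k + d) %% e = if e <= k + d then k + d - e else k + d.
Proof.
move=> ke de; case: leqP => ekd; last by rewrite modn_small.
by rewrite -{1}(subnK ekd) modnDr modn_small //; lia.
Qed.

Lemma runner_betasetS e r l k : size l <= r -> k < e ->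
  runner e (betaset r.+1 l) ((k + 1) %% e) =
  runner e (betaset r l) k + (k.+1 == e).
Proof.
move=> lr ke; rewrite /runner count_betasetS //.
have -> : (0 %% e == (k + 1) %% e) = (k.+1 == e).
  by rewrite mod0n modnD_small //; case: leqP; lia.
congr (_ + _); apply: eq_count => x /=.
rewrite -addn1 eqn_modDr (modn_small ke).
by [].
Qed.

(** Dropping a bead shifts the runners by one; the bead 0 that disappears accounts for the shift of
    the term [e <= k + 2]. *)
Lemma dominant_betaset_pred e r l : 2 < e -> size l <= r ->
  dominant e (betaset r.+1 l) -> dominant e (betaset r l).
Proof.
move=> e2 lr dom k ke; have e0 : 0 < e by lia.
have := dom ((k + 1) %% e); rewrite ltn_mod => /(_ e0).
have -> : ((k + 1) %% e + 2) %% e = ((k + 2) %% e + 1) %% e.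
  by rewrite !modnDml addnAC.
rewrite !runner_betasetS ?ltn_mod //.
have := modnD_small ke (d := 1); have := modnD_small ke (d := 2).
move: ((k + 1) %% e) ((k + 2) %% e) (runner _ _ _) (runner _ _ _) => a b u v.
by case: (leqP e (k + 2)) => k2; case: (leqP e (k + 1)) => k1; lia.
Qed.

Lemma dominant_betaset e r l : 2 < e -> size l <= r ->
  dominant e (betaset r l) -> dominant e (betaset (size l) l).
Proof.
move=> e2 /subnK <-; elim: (r - size l) => //= d IH; rewrite addSn.
by move/(dominant_betaset_pred e2) => /(_ (leq_addl _ _)).
Qed.

(** Going from x to x + 2 raises the level [x %/ e] exactly when [e <= x %% e + 2]; this carry is
    the correction term of [dominant]. *)
Lemma dominant_closed2 e X : 1 < e -> dominant e X -> closed2 (core_beads e X).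
Proof.
move=> e1 dom x; have e0 : 0 < e by lia.
rewrite !mem_core_beads // -/(runner _ _ _) -/(runner _ _ _).
have := dom (x %% e); rewrite ltn_mod modnDml addn2 => /(_ e0).
have -> : x.+2 %/ e = x %/ e + (e <= (x %% e).+2).
  rewrite -addn2 {1}(divn_eq x e) -addnA divnMDl // addn2; congr (_ + _).
  have := ltn_pmod x e0; move: (x %% e) => k ke.
  case: leqP => ek; last by rewrite divn_small.
  by rewrite -(subnK ek) divnDr // divnn e0 divn_small //; lia.
by rewrite -addn2; lia.
Qed.

Lemma count_parity (P : pred nat) X :
  count P X = count (fun x => (odd x == false) && P x) X
              + count (fun x => (odd x == true) && P x) X.
Proof. by elim: X => //= x X ->; case: (odd x) => /=; lia. Qed.

Lemma count_betaset_part (P : pred nat) Y : uniq Y ->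
  count P (betaset (size Y).+1 (part_of_beta Y)) = count (P \o S) Y + P 0.
Proof.
move=> uY; rewrite count_betasetS ?size_part_of_beta //.
by rewrite part_of_betaK // count_sort.
Qed.

Definition halves (b : bool) (X : seq nat) : seq nat :=
  [seq x./2 | x <- X & odd x == b].

Lemma uniq_halves b X : uniq X -> uniq (halves b X).
Proof.
move=> uX; rewrite map_inj_in_uniq ?filter_uniq // => x y.
rewrite !mem_filter => /andP[/eqP xb _] /andP[/eqP yb _] E.
by rewrite -(odd_double_half x) -(odd_double_half y) xb yb E.
Qed.

(* The two extra beads of [betaset r.+2 l] put one more bead on each runner; this
   bead stands for the empty row below [part_of_beta Y], where a node may be added. *)
Lemma count_halves (P : pred nat) b r l : sorted geq l -> size l <= r ->
  let Y := halves b (betaset r l) in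
  count P (betaset (size Y).+1 (part_of_beta Y))
  = count (fun x => (odd x == b) && P x./2) (betaset r.+2 l).
Proof.
move=> sl lr Y; rewrite count_betaset_part ?uniq_halves ?betaset_uniq //.
rewrite !count_betasetS // 1?leqW // /Y count_map count_filter /=.
rewrite -addnA; congr (_ + _); last by case: b {Y}; rewrite //= addn0.
by apply: eq_count => x /=; rewrite negbK andbC.
Qed.

(** As 2 is invertible modulo the odd number [e], contents may be compared after doubling, where the
    halved beads become linear in [x]. *)
Lemma residue_double e (z h : int) (x k : nat) : odd e -> k < e ->
  (Posz e %| (2%:Z * z - 2%:Z * h) - (Posz x - Posz k))%Z%R ->
  ((z %% e)%Z == (h %% e)%Z) = (x %% e == k).
Proof.
move=> oe ke dv.
have -> : (x %% e == k) = (Posz e %| Posz x - Posz k)%Z%R.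
  by rewrite -eqz_mod_dvd !modz_nat eqz_nat (modn_small ke).
have -> : (Posz x - Posz k
  = 2%:Z * (z - h) - ((2%:Z * z - 2%:Z * h) - (Posz x - Posz k)))%R.
  by lia.
rewrite eqz_mod_dvd (rpredBr _ dv) Gauss_dvdzr //.
by rewrite coprimezE /= coprimen2.
Qed.

(** * From highest weight vertices to inequalities between runners *)

Lemma highest_weight_removables e c mu i : 1 < e -> i < e ->
  is_bipartition mu -> highest_weight e c mu ->
  count (has_residue e c i) (removables mu.1 1)
    + count (has_residue e c i) (removables mu.2 2)
  <= count (has_residue e c i) (addables mu.1 1)
    + count (has_residue e c i) (addables mu.2 2).
Proof.
move=> e1 ie bmu /(highest_weight_count e1 ie bmu).
rewrite /letters; move: (addables _ _) (addables _ _) => A1 A2.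
move: (removables _ _) (removables _ _) => R1 R2.
rewrite !map_cat !count_cat !count_map.
have cT s : count (preim (fun x : node => (true, x))
    (fun u : letter => has_residue e c i u.2 && ~~ u.1)) s = 0.
  by rewrite -(count_pred0 s); apply: eq_count => x; rewrite /= andbF.
have cF s : count (preim (fun x : node => (false, x))
    (fun u : letter => has_residue e c i u.2 && u.1)) s = 0.
  by rewrite -(count_pred0 s); apply: eq_count => x; rewrite /= andbF.
have cT' s : count (preim (fun x : node => (true, x))
    (fun u : letter => has_residue e c i u.2 && u.1)) s = count (has_residue e c i) s.
  by apply: eq_count => x; rewrite /= andbT.
have cF' s : count (preim (fun x : node => (false, x))
    (fun u : letter => has_residue e c i u.2 && ~~ u.1)) s
  = count (has_residue e c i) s.
  by apply: eq_count => x; rewrite /= andbT.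
by rewrite ?cT ?cF ?cT' ?cF'; lia.
Qed.

Lemma has_residue_addable e c i p j (cj := if j == 1 then c.1 else c.2) :
  count (has_residue e c i) (addables p j) =
  count ((fun z => ((z + cj) %% e)%Z == i)%R \o diag) (addables p j).
Proof.
apply: eq_in_count => x; rewrite mem_addables_comp => /and4P[/eqP xj _ _ _].
by rewrite /has_residue /content xj.
Qed.

Lemma has_residue_removable e c i p j (cj := if j == 1 then c.1 else c.2) :
  count (has_residue e c i) (removables p j) =
  count ((fun z => ((z + cj) %% e)%Z == i)%R \o diag) (removables p j).
Proof.
apply: eq_in_count => x; rewrite mem_removables_comp => /and4P[/eqP xj _ _ _].
by rewrite /has_residue /content xj.
Qed.

(** This is [bead_count] read on beads of one parity: a step of 1 on the component is a step of 2
    here, and a positive bead there is a bead above 1 here. *)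
Lemma bead_count_halves (Q : int -> bool) b e k j r l :
  is_partition l -> size l <= r ->
  let Y := halves b (betaset r l) in
  (forall x, odd x = b ->
     Q (Posz x./2 - Posz (size Y).+1)%R = (x %% e == k)) ->
  count (Q \o diag) (addables (part_of_beta Y) j)
    + count (fun x => (odd x == b) && ((1 < x) && (x %% e == k)))
        (betaset r.+2 l)
  = count (Q \o diag) (removables (part_of_beta Y) j)
    + count (fun x => (odd x == b) && ((x + 2) %% e == k)) (betaset r.+2 l).
Proof.
move=> pl lr Y QE; have sl := partition_sorted pl.
have uY : uniq Y by rewrite uniq_halves ?betaset_uniq.
have := bead_count Q j (n := (size Y).+1) (p := part_of_beta Y).
rewrite ltnS size_part_of_beta => /(_ isT (partition_part_of_beta uY)).
rewrite !count_halves //.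
rewrite (eq_count (a2 := fun x => (odd x == b) && ((1 < x) && (x %% e == k)))).
  rewrite [X in _ = _ + X]
    (eq_count (a2 := fun x => (odd x == b) && ((x + 2) %% e == k))) //.
  move=> x /=; case: eqP => //= xb; rewrite -QE; last by rewrite oddD addbF.
  by rewrite addn2.
move=> x /=; case: eqP => //= xb; rewrite QE //; congr (_ && _).
by case: x {xb} => [|[|x]].
Qed.

(** The boolean [b] records a swap of the two components. The divisibility makes residues the same
    function of the bead for both parities. *)
Lemma highest_weight_dominant e c mu lam r (b : bool) :
  odd e -> 2 < e -> is_partition lam -> size lam <= r ->
  is_bipartition mu -> highest_weight e c mu ->
  let E := halves false (betaset r lam) in
  let O := halves true (betaset r lam) in
  mu = (if b then (part_of_beta O, part_of_beta E)
        else (part_of_beta E, part_of_beta O)) ->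
  (Posz e %| 2%:Z * (Posz (size E) - Posz (size O)) - 1
     + 2%:Z * (if b then c.1 - c.2 else c.2 - c.1))%Z%R ->
  dominant e (betaset r.+2 lam).
Proof.
move=> oe e2 pl lr bmu hw E O mu_def dvc k ke.
have e0 : 0 < e by lia.
have sl := partition_sorted pl.
set cE := if b then c.2 else c.1; set cO := if b then c.1 else c.2.
pose k2 := (k + 2) %% e.
have k2e : k2 < e by rewrite ltn_mod.
(* For an even bead [x] congruent to [k2], this is modulo [e] twice [x./2 - (size E).+1 + cE]. *)
pose w : int := (Posz k2 - 2%:Z * Posz (size E).+1 + 2%:Z * cE)%R.
(* [(e + 1) / 2] is the inverse of 2 modulo [e], so [2 h = w] modulo [e]. *)
pose h : int := (Posz (e.+1)./2 * w)%R.
have hE : (2%:Z * h = w + Posz e * w)%R.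
  have -> : (Posz e = 2%:Z * Posz (e.+1)./2 - 1)%R by lia.
  rewrite /h; move: (Posz _) => u; lia.
(* Removable [i]-nodes then sit at beads congruent to [k2], addable ones at beads congruent to
   [k]. *)
have [i ie iE] : exists2 i, i < e & Posz i = (h %% e)%Z.
  exists `|(h %% e)%Z|%N; last by rewrite gez0_abs // modz_ge0 //; lia.
  by have := ltz_pmod h (d := e); have := @modz_ge0 h e; lia.
pose Q cj (z : int) := (((z + cj)%R %% e)%Z == i)%R.
have wE : w = (Posz k2 - 2%:Z * Posz (size E).+1 + 2%:Z * cE)%R by [].
clearbody w h.
have QE x : odd x = false ->
    Q cE (Posz x./2 - Posz (size E).+1)%R = (x %% e == k2).
  move=> ox; rewrite /Q iE; apply: residue_double => //.
  suff -> : (2%:Z * (Posz x./2 - Posz (size E).+1 + cE) - 2%:Z * h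
             - (Posz x - Posz k2) = - (Posz e * w))%R.
    by rewrite rpredN dvdz_mulr.
  by rewrite hE wE; move: (Posz e * _)%R => ew; lia.
(* Here [x./2] is (x - 1) / 2, and the discrepancy with even beads is the integer that [dvc] makes
   divisible by [e]. *)
have QO x : odd x = true ->
    Q cO (Posz x./2 - Posz (size O).+1)%R = (x %% e == k2).
  move=> ox; rewrite /Q iE; apply: residue_double => //.
  suff -> : (2%:Z * (Posz x./2 - Posz (size O).+1 + cO) - 2%:Z * h
             - (Posz x - Posz k2)
           = (2%:Z * (Posz (size E) - Posz (size O)) - 1
               + 2%:Z * (if b then c.1 - c.2 else c.2 - c.1)) - Posz e * w)%R.
    by rewrite rpredB ?dvdz_mulr.
  rewrite hE wE /cE /cO; move: (Posz e * _)%R => ew.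
  by case: (b); lia.
have cntE j := bead_count_halves j pl lr QE.
have cntO j := bead_count_halves j pl lr QO.
have exchange (a x s y a' x' s' y' : nat) : a + x = s + y ->
  a' + x' = s' + y' -> s + s' <= a + a' -> x + x' <= y + y' by lia.
have le_counts :
   count (fun x => (1 < x) && (x %% e == k2)) (betaset r.+2 lam) <=
   count (fun x => (x + 2) %% e == k2) (betaset r.+2 lam).
  have := highest_weight_removables (ltnW e2) ie bmu hw.
  rewrite !has_residue_addable !has_residue_removable.
  rewrite (count_parity (fun x => (1 < x) && (x %% e == k2))).
  rewrite (count_parity (fun x => (x + 2) %% e == k2)).
  rewrite mu_def; move: cntE cntO; rewrite /cE /cO /Q -/E -/O.
  case: (b) => cntE cntO.
    rewrite addnC (addnC (count _ (addables _ 1))).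
    exact: (exchange _ _ _ _ _ _ _ _ (cntE 2) (cntO 1)).
  exact: (exchange _ _ _ _ _ _ _ _ (cntE 1) (cntO 2)).
have -> : runner e (betaset r.+2 lam) k
          = count (fun x => (x + 2) %% e == k2) (betaset r.+2 lam).
  by apply: eq_count => x; rewrite /k2 eqn_modDr (modn_small ke).
apply: leq_trans (leq_add le_counts (leqnn _)).
(* The residue wraps around exactly when it becomes 0 or 1; then [k2] itself is the only bead of its
   runner that [1 < x] can exclude. *)
have -> : (e <= k + 2) = (k2 < 2).
  by rewrite /k2 modnD_small //; case: (leqP e (k + 2)); lia.
have uB : uniq (betaset r.+2 lam) by rewrite betaset_uniq.
have := count_uniq_mem k2 uB; rewrite /runner -/k2.
case: (ltnP k2 2) => k22 cB.
  have cB1 : count_mem k2 (betaset r.+2 lam) <= 1 by rewrite cB leq_b1.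
  apply: leq_trans (leq_add (leqnn _) cB1); rewrite -count_predUI.
  apply: leq_trans (leq_addr _ _); apply: sub_count => x /= /eqP xk.
  rewrite xk eqxx andbT; case: (ltnP 1 x) => //= x2.
  by rewrite -xk modn_small //; lia.
rewrite addn0; apply: sub_count => x /eqP xk; rewrite xk eqxx andbT.
by have := leq_mod x e; rewrite xk; lia.
Qed.

(** * The 2-core and the numbers of even and odd beads *)

Lemma core_beads2E X : core_beads 2 X =
  [seq i.*2 | i <- iota 0 (count (predC odd) X)]
  ++ [seq i.*2.+1 | i <- iota 0 (count odd X)].
Proof.
rewrite /core_beads /= cats0.
have -> : count (fun x => x %% 2 == 0) X = count (predC odd) X.
  by apply: eq_count => x; rewrite modn2 eqb0.
have -> : count (fun x => x %% 2 == 1) X = count odd X.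
  by apply: eq_count => x; rewrite modn2 eqb1.
by congr cat; apply: eq_map => i; rewrite mul2n.
Qed.

Lemma size_core_beads2 X : size (core_beads 2 X) = size X.
Proof.
by rewrite core_beads2E size_cat !size_map !size_iota addnC count_predC.
Qed.

Lemma count_odd_core_beads2 X : count odd (core_beads 2 X) = count odd X.
Proof.
rewrite core_beads2E count_cat !count_map.
rewrite (eq_count (a2 := pred0)) ?count_pred0 => [|i]; last by rewrite /= odd_double.
rewrite [LHS](eq_count (a2 := predT)) => [|i]; last by rewrite /= odd_double.
by rewrite count_predT size_iota.
Qed.

Lemma balanceE X : balance X = (Posz (size X) - 2%:Z * Posz (count odd X))%R.
Proof. by rewrite /balance -(count_predC odd X); lia. Qed.

(** Sliding on two runners preserves the numbers of even and odd beads; every further bead changes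
    both balances in the same way. *)
Lemma balance_core2 r t lam : is_partition lam -> ecore 2 lam = staircase t ->
  size lam <= r ->
  t <= r /\ balance (betaset r lam) = balance (betaset r (staircase t)).
Proof.
move=> pl core lr; set X := core_beads 2 (betaset (size lam) lam).
have uX : uniq X by exact: uniq_core_beads.
have szX : size X = size lam by rewrite size_core_beads2 size_betaset.
have stE : staircase t = part_of_beta X by rewrite -core.
have st : size (staircase t) = t by rewrite size_map size_iota.
have ts : size (staircase t) <= size lam by rewrite stE -szX size_part_of_beta.
have base : balance (betaset (size lam) lam)
            = balance (betaset (size lam) (staircase t)).
  rewrite stE -szX part_of_betaK // !balanceE size_betaset size_sort count_sort.
  by rewrite szX count_odd_core_beads2.
split; first by rewrite -st (leq_trans ts).
rewrite -(subnK lr); elim: (r - _) => //= d IH.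
by rewrite addSn !balanceS ?IH ?leq_addl // (leq_trans ts) ?leq_addl.
Qed.

Theorem theorem7p6 (e t : nat) (mu : seq nat * seq nat) :
  1 < e -> odd e ->
  is_bipartition mu ->
  highest_weight e (charge e t) mu ->
  forall lam : seq nat, Phi_rel t mu lam -> is_core 2 (ecore e lam).
Proof.
move=> e1 oe bmu hw lam /and3P[pl /eqP core /eqP quot].
have e2 : 2 < e by case: e e1 oe {hw} => [|[|[|e]]].
have sl := partition_sorted pl.
apply: is_core2; first by apply: uniq_core_beads; lia.
apply: dominant_closed2 => //.
pose r := if odd (size lam) then size lam else (size lam).+1.
have lr : size lam <= r by rewrite /r; case: ifP.
have rodd : odd r by rewrite /r; case: ifP => //= ->.
(* The core is computed with [size lam] beads, the quotient with the odd number [r], and the node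
   counts with two beads more. *)
apply: (@dominant_betaset _ r.+2) => //; first by rewrite !leqW.
apply: (highest_weight_dominant (b := odd t) oe e2 pl lr bmu hw).
  rewrite -quot /barquot2 /quot2 -/r.
  have -> : [seq x./2 | x <- betaset r lam & ~~ odd x] = halves false (betaset r lam).
    by congr map; apply: eq_filter => x; rewrite eqbF_neg.
  have -> : [seq x./2 | x <- betaset r lam & odd x] = halves true (betaset r lam).
    by congr map; apply: eq_filter => x; rewrite eqb_id.
  by [].
have [tr] := balance_core2 pl core lr.
have -> : balance (betaset r lam) = (Posz (size (halves false (betaset r lam)))
    - Posz (size (halves true (betaset r lam))))%R.
  rewrite /balance !size_map !size_filter.
  by congr (Posz _ - Posz _)%R; apply: eq_count => x; rewrite ?eqbF_neg ?eqb_id.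
rewrite balance_staircase // oddB // rodd /charge /= => ->.
(* As [r] is odd, the balance is -t for odd [t] and t + 1 for even [t]; with the given charge the
   integer to be divided is -e or e. *)
case: (odd t) => /=.
  suff -> : (2%:Z * - Posz t - 1 + 2%:Z * (Posz t - Posz (e.-1)./2 - 0)
             = - Posz e)%R by rewrite rpredN dvdzz.
  lia.
suff -> : (2%:Z * Posz t.+1 - 1 + 2%:Z * (0 - (Posz t - Posz (e.-1)./2))
           = Posz e)%R by rewrite dvdzz.
lia.
Qed.
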